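(* Let $Z=X\oplus Y$ be a Banach space with closed linear subspaces $X$, $Y$. View two linear subspaces $M$ and $N$ of $Z$ as linear relations between $X$ and $Y$. Denote by $P$ the bounded projection of $Z$ onto $X$ along $Y$, and put $\eta(X,Y):=\|P\|+\|I-P\|\ge1$. Then $$a(N)\ge\frac{\dfrac{1-\delta(N0,M0)}{1+\delta(N0,M0)}\,a(M)-\eta(X,Y)(2+a(M))\,\delta(M,N)}{1+\|P\|(2+a(M))\,\delta(M,N)},$$ $$\|N\|\ge\frac{\dfrac{1-\delta(N0,M0)}{1+\delta(N0,M0)}\,\|M\|-\|I-P\|(1+\|M\|)\,\delta(M,N)}{1+\|P\|(1+\|M\|)\,\delta(M,N)}.$$
   Context: For a linear subspace $M\subset Z=X\oplus Y$ viewed as a linear relation: $\operatorname{dom}(M)=\{x\in X:\exists y\in Y,\ x+y\in M\}$, $Mx=\{y\in Y:x+y\in M\}$ for $x\in\operatorname{dom}(M)$, and $M0=M\cap Y$. Define $$a(M)=\sup_{x\in\operatorname{dom}(M)\setminus\{0\}}\frac{\operatorname{dist}(x,Mx)}{\|x\|},\qquad \|M\|=\sup_{x\in\operatorname{dom}(M)\setminus\{0\}}\ \inf_{y\in Mx}\frac{\|y\|}{\|x\|}$$ if $\operatorname{dom}(M)\ne\{0\}$, and $a(M)=\|M\|=0$ if $\operatorname{dom}(M)=\{0\}$. Here $\operatorname{dist}(x,Mx)=\inf_{y\in Mx}\|x-y\|$. For linear subspaces $M,N$ of $Z$: $\delta(M,N)=\sup\{\operatorname{dist}(u,N):u\in M,\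 \|u\|=1\}$ if $M\neq\{0\}$, and $\delta(\{0\},N)=0$. *)

(* Defs.v *)
From HB Require Import structures.
From mathcomp Require Export all_boot all_order all_algebra.
From mathcomp Require Export complex.
From mathcomp Require Export all_classical all_reals all_analysis.

Set Implicit Arguments.
Unset Strict Implicit.
Unset Printing Implicit Defensive.

Export Order.TTheory GRing.Theory Num.Theory.
Export numFieldNormedType.Exports.

Local Open Scope classical_set_scope.
Local Open Scope ring_scope.

Variant scalars := RealScalars | ComplexScalars.

Definition scalar_field (R : realType) (k : scalars) : numFieldType :=
  match k with
  | RealScalars => R
  | ComplexScalars => R[i]
  end.

Definition re_scalar (R : realType) (k : scalars) : scalar_field R k -> R :=
  match k with
  | RealScalars => id
  | ComplexScalars => @complex.Re R
  end.

Section LinearRelations.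
Context {R : realType} {k : scalars} {Z : normedModType (scalar_field R k)}.
Implicit Types (X Y M N A : set Z) (x y z u : Z).

(* The library norm takes its (real, nonnegative) values in the scalar field,
   which may be R[i]; suprema and infima are taken in R. *)
Definition nrm z : R := re_scalar `|z|.

Definition is_subspace A : Prop :=
  A 0 /\ forall (c : scalar_field R k) u v, A u -> A v -> A (c *: u + v).

Definition direct_sum X Y : Prop :=
  X `&` Y = [set 0] /\
  forall z, exists x y, [/\ X x, Y y & z = x + y].

(* When Z is the direct sum of X and Y this determines P. *)
Definition projection_along X Y (P : Z -> Z) : Prop :=
  forall z, X (P z) /\ Y (z - P z).

Definition opnorm (T : Z -> Z) : \bar R :=
  ereal_sup [set (nrm (T z))%:E | z in [set z | nrm z <= 1]].

(* Infimum in R: only meaningful for nonempty A. *)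
Definition dist z A : R := inf [set nrm (z - v) | v in A].

Definition rel_dom X Y M : set Z :=
  [set x | X x /\ exists2 y, Y y & M (x + y)].

Definition rel_img Y M x : set Z := [set y | Y y /\ M (x + y)].

Definition rel_a X Y M : \bar R :=
  if `[< rel_dom X Y M = [set 0] >] then 0%E
  else ereal_sup [set (dist x (rel_img Y M x) / nrm x)%:E
                 | x in rel_dom X Y M `\ 0].

Definition rel_norm X Y M : \bar R :=
  if `[< rel_dom X Y M = [set 0] >] then 0%E
  else ereal_sup [set (inf [set nrm y / nrm x | y in rel_img Y M x])%:E
                 | x in rel_dom X Y M `\ 0].

(* The set of distances is bounded above by 1 when N is a subspace. *)
Definition gap M N : R :=
  if `[< M = [set 0] >] then 0
  else sup [set dist u N | u in [set u | M u /\ nrm u = 1]].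

End LinearRelations.

(* Value at an extended real of an expression in one real variable, an
   infinite argument being read as a limit. *)
Definition eval_ext {R : realType} (f : R -> R) (t : \bar R) : \bar R :=
  match t with
  | r%:E => (f r)%:E
  | +oo%E => lim ((f s)%:E @[s --> +oo])
  | -oo%E => lim ((f s)%:E @[s --> -oo])
  end.

(* Main.v *)
Require Import Defs.
From mathcomp Require Import ring lra.

(** The projection [P] is bounded by the closed graph theorem, proved here over
    either scalar field by a Baire argument and successive approximation.

    The distance from [c x] to [M x] (with [c = 1] for [a(M)] and [c = 0] for
    [||M||]) is the distance from [c x - y] to [M 0] for any [y] in [M x].  Take
    [y] almost optimal and [v = x' + y'] in [N] close to [u = x + y]:
    then [x'] and [y'] are close to [x] and [y], by [||P||] and [||I - P||].
    Replacing [M 0] by [N 0] costs [dist w (M 0) <= (1 + d0) dist w (N 0) +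
    d0 ||w||] with [||w||] almost equal to [dist w (M 0)], hence the factor
    [(1 - d0) / (1 + d0)].  This bounds the Moebius expression at every
    quotient [dist (c x) (M x) / ||x||], and the bound passes to their
    supremum. *)

Set Implicit Arguments.
Unset Strict Implicit.
Unset Printing Implicit Defensive.

Local Open Scope classical_set_scope.
Local Open Scope ring_scope.

(** * Real numbers inside the real or complex scalar field *)

Section RealScalars.
Context {R : realType} {k : scalars}.

Definition realc : R -> scalar_field R k :=
  match k return R -> scalar_field R k with
  | RealScalars => id
  | ComplexScalars => @real_complex R
  end.

Lemma re_scalarK : cancel realc (@re_scalar R k).
Proof. by rewrite /realc /re_scalar; case: (k). Qed.

Lemma realc_re (c : scalar_field R k) : 0 <= c -> realc (re_scalar c) = c.
Proof.
rewrite /realc /re_scalar; case: (k) c => //= -[a b].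
by rewrite lecE /= => /andP[/eqP -> _].
Qed.

Lemma re_scalarD (c d : scalar_field R k) :
  re_scalar (c + d) = re_scalar c + re_scalar d.
Proof. by rewrite /re_scalar; case: (k) c d => //= -[a b] [c d]. Qed.

(** A nonnegative element of [R[i]] has zero imaginary part, so the cross term in the real part of
    the product vanishes. *)
Lemma re_scalarM (c d : scalar_field R k) : 0 <= c ->
  re_scalar (c * d) = re_scalar c * re_scalar d.
Proof.
rewrite /re_scalar; case: (k) c d => //= -[a b] [c d].
by rewrite lecE /= => /andP[/eqP -> _]; rewrite mul0r subr0.
Qed.

Lemma ler_re_scalar (c d : scalar_field R k) :
  c <= d -> re_scalar c <= re_scalar d.
Proof.
by rewrite /re_scalar; case: (k) c d => //= -[a b] [c d]; rewrite lecE => /andP[].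
Qed.

Lemma ltr_re_scalar (c d : scalar_field R k) :
  c < d -> re_scalar c < re_scalar d.
Proof.
by rewrite /re_scalar; case: (k) c d => //= -[a b] [c d]; rewrite ltcE => /andP[].
Qed.

Lemma ltr_realc (r s : R) : (realc r < realc s) = (r < s).
Proof. by rewrite /realc; case: (k) => //=; rewrite ltcR. Qed.

Lemma realc0 : realc 0 = 0.
Proof. by rewrite /realc; case: (k). Qed.

Lemma normr_realc (r : R) : `|realc r| = realc `|r|.
Proof. by rewrite /realc; case: (k) => //=; rewrite normc_def /= expr0n addr0 sqrtr_sqr. Qed.

Lemma realc_eq0 (r : R) : (realc r == 0) = (r == 0).
Proof. by rewrite -realc0 (can_eq re_scalarK). Qed.

Lemma realcV (r : R) : realc r^-1 = (realc r)^-1.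
Proof. by rewrite /realc; case: (k) => //=; rewrite fmorphV. Qed.

End RealScalars.

(** * The real-valued norm *)

Section RealNorm.
Context {R : realType} {k : scalars} {Z : normedModType (scalar_field R k)}.
Implicit Types (x y z u v w : Z).

Lemma nrmE z : `|z| = realc (nrm z).
Proof. by rewrite realc_re. Qed.

Lemma nrm_ge0 z : 0 <= nrm z.
Proof. by have := ler_re_scalar (normr_ge0 z); rewrite -realc0 re_scalarK. Qed.

Lemma nrm0 : nrm (0 : Z) = 0.
Proof. by rewrite /nrm normr0 -realc0 re_scalarK. Qed.

Lemma nrm_eq0 z : (nrm z == 0) = (z == 0).
Proof. by rewrite -(realc_eq0 (k := k)) -nrmE normr_eq0. Qed.

Lemma nrm_gt0 z : (0 < nrm z) = (z != 0).
Proof. by rewrite lt_def nrm_ge0 nrm_eq0 andbT. Qed.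

Lemma nrmN z : nrm (- z) = nrm z.
Proof. by rewrite /nrm normrN. Qed.

Lemma nrmB z w : nrm (z - w) = nrm (w - z).
Proof. by rewrite -nrmN opprB. Qed.

Lemma ler_nrmD z w : nrm (z + w) <= nrm z + nrm w.
Proof. by rewrite /nrm -re_scalarD ler_re_scalar// ler_normD. Qed.

Lemma ler_nrm_sub z w : nrm (z - w) <= nrm z + nrm w.
Proof. by rewrite -(nrmN w) ler_nrmD. Qed.

Lemma ler_nrm_dist z w : nrm z <= nrm (z - w) + nrm w.
Proof. by rewrite -{1}(subrK w z) ler_nrmD. Qed.

Lemma ler_nrm_triangle y z w : nrm (z - w) <= nrm (z - y) + nrm (y - w).
Proof. by rewrite -{1}(subrKA y) ler_nrmD. Qed.

Lemma nrmZ (r : R) z : nrm (realc r *: z) = `|r| * nrm z.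
Proof. by rewrite /nrm normrZ re_scalarM// normr_realc re_scalarK. Qed.

Lemma nrmMn z n : nrm (z *+ n) = nrm z *+ n.
Proof.
rewrite /nrm normrMn; elim: n => [|n IHn]; last by rewrite !mulrS re_scalarD IHn.
by rewrite !mulr0n -realc0 re_scalarK.
Qed.

Lemma cvg_nrmP (u : nat -> Z) (l : Z) :
  u @ \oo --> l <-> forall e : R, 0 < e -> \forall n \near \oo, nrm (l - u n) < e.
Proof.
split=> [/cvgrPdist_lt ul e e0|ul].
  have : 0 < realc e :> scalar_field R k by rewrite -realc0 ltr_realc.
  by move/ul; apply: filterS => n; rewrite nrmE ltr_realc.
apply/cvgrPdist_lt => e e0.
rewrite -(realc_re (ltW e0)); have := ltr_re_scalar e0.
rewrite -{1}realc0 re_scalarK => /ul.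
by apply: filterS => n; rewrite nrmE ltr_realc.
Qed.

End RealNorm.

(** * Completeness: telescoping bounds and Baire's theorem *)

Section Completeness.
Context {R : realType} {k : scalars}
        {Z : completeNormedModType (scalar_field R k)}.

(** The increments add up to at most [s n - s (n + m)], so [u] is Cauchy and the tail bound passes
    to the limit. It serves shrinking balls, with [s] the radii, and geometric series, with [s] the
    remainders. *)
Lemma cvg_telescope (u : nat -> Z) (s : nat -> R) :
    (forall n, nrm (u n.+1 - u n) <= s n - s n.+1) -> s @ \oo --> 0 ->
  exists2 l, u @ \oo --> l & forall n, nrm (l - u n) <= s n.
Proof.
move=> us s0.
have s_le n m : nrm (u (n + m)%N - u n) <= s n - s (n + m)%N.
  elim: m => [|m IHm]; first by rewrite addn0 !subrr nrm0.
  apply: le_trans (ler_nrm_triangle (u (n + m)%N) _ _) _.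
  by have := us (n + m)%N; rewrite addnS; lra.
have ds : {homo s : n m / (n <= m)%N >-> m <= n}.
  by apply/nonincreasing_seqP => n; have := us n; have := nrm_ge0 (u n.+1 - u n); lra.
have s_ge0 n : 0 <= s n.
  by rewrite -(cvg_lim _ s0)//; apply: nonincreasing_cvgn_ge => //; apply/cvg_ex; exists 0.
have u_cvg : cvg (u @ \oo).
  apply/cauchy_cvgP/cauchy_exP => e e0.
  have : 0 < re_scalar e by have := ltr_re_scalar e0; rewrite -[0]realc0 re_scalarK.
  move/cvgrPdist_lt : s0 => /[apply] -[n _ sn].
  exists (u n); exists n => // m /= nm.
  rewrite -ball_normE /ball_/= -(realc_re (ltW e0)) nrmE ltr_realc nrmB.
  have := s_le n (m - n)%N; have := s_ge0 m.
  by have := sn n (leqnn n); rewrite subnKC// sub0r normrN ger0_norm//; lra.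
exists (lim (u @ \oo)) => // n; apply/ler_addgt0Pr => e e0.
have /cvg_nrmP/(_ e e0)[m _ um] := u_cvg.
have := um (n + m)%N (leq_addl _ _) => /=.
have := ler_nrm_triangle (u (n + m)%N) (lim (u @ \oo)) (u n).
by have := s_le n m; have := s_ge0 (n + m)%N; lra.
Qed.

(** Were no [A n] dense in any ball, every ball would contain a smaller closed ball missing [A n];
    the centres of such nested balls converge to a point outside every [A n]. *)
Lemma baire_ball (A : nat -> set Z) :
    (forall z, exists n, A n z) ->
  exists n a r, 0 < r /\
    forall z e, nrm (z - a) < r -> 0 < e -> exists2 w, A n w & nrm (w - z) < e.
Proof.
move=> A_cover; apply: contrapT => nA.
(* Pairs are centre and radius: the closed ball [q] lies in [p], has at most half its radius and
   misses [A n]. *)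
pose step n (p q : Z * R) := [/\ 0 < q.2, nrm (q.1 - p.1) <= p.2 - q.2,
  q.2 <= p.2 / 2 & forall w, A n w -> q.2 < nrm (w - q.1)].
have /choice[f f_step] (np : nat * (Z * R)) :
    exists q, 0 < np.2.2 -> step np.1 np.2 q.
  case: np => n [a r] /=.
  have [r0|] := ltP 0 r; last by exists (a, r).
  have [b [e [bar e0 be]]] : exists b e,
      [/\ nrm (b - a) < r, 0 < e & forall w, A n w -> e <= nrm (w - b)].
    apply: contrapT => nb; apply: nA; exists n, a, r; split=> // z e zar e0.
    apply: contrapT => nw; apply: nb; exists z, e; split=> // w Aw.
    by rewrite leNgt; apply/negP => we; apply: nw; exists w.
  exists (b, Num.min (r - nrm (b - a)) e / 2) => _.
  have nb := nrm_ge0 (b - a).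
  have m_gt0 : 0 < Num.min (r - nrm (b - a)) e by rewrite lt_min e0 subr_gt0 bar.
  have m_ler : Num.min (r - nrm (b - a)) e <= r - nrm (b - a) by rewrite ge_min lexx.
  have m_lee : Num.min (r - nrm (b - a)) e <= e by rewrite ge_min lexx orbT.
  by split=> /= [|||w /be]; lra.
pose fix c n : Z * R := if n is m.+1 then f (m, c m) else (0, 1).
have c_gt0 n : 0 < (c n).2.
  by elim: n => //= n IHn; have [] := f_step (n, c n) IHn.
have c_step n : step n (c n) (c n.+1) by exact: (f_step (n, c n) (c_gt0 n)).
have c_le n : (c n).2 <= 2^-1 ^+ n.
  elim: n => [|n IHn]; first by rewrite expr0.
  by have [_ _ cn _] := c_step n; rewrite exprS; lra.
have c0 : (c n).2 @[n --> \oo] --> (0 : R).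
  apply: (@squeeze_cvgr _ _ _ _ (fun=> 0) (fun n => 2^-1 ^+ n)).
  - by near=> n; rewrite ltW ?c_gt0//=.
  - exact: cvg_cst.
  - by apply: cvg_expr; rewrite ger0_norm; lra.
have [|l _ lc] := @cvg_telescope (fst \o c) (snd \o c) _ c0.
  by move=> n; have [] := c_step n.
have [n Anl] := A_cover l.
have [_ _ _ /(_ l Anl)] := c_step n.
by have := lc n.+1 => /=; lra.
Unshelve. all: by end_near. Qed.

End Completeness.

(** * The closed graph theorem *)

Section ClosedGraph.
Context {R : realType} {k : scalars}
        {Z W : completeNormedModType (scalar_field R k)}.

(** By Baire, the vectors with image of norm at most some [n] are dense in a ball. Their rescaled
    differences approximate any [z] with image bounded by [C * nrm z]; approximating the residuals
    in turn makes the error vanish in the limit. *)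
Lemma closed_graph (T : Z -> W) : linear T ->
    (forall (u : nat -> Z) l t, u @ \oo --> l -> T \o u @ \oo --> t -> T l = t) ->
  exists2 C, 0 <= C & forall z, nrm (T z) <= C * nrm z.
Proof.
move=> T_lin T_graph.
have TD x y : T (x + y) = T x + T y by have := T_lin 1 x y; rewrite !scale1r.
have T0 : T 0 = 0 by apply: (addrI (T 0)); rewrite -TD !addr0.
have TZ c x : T (c *: x) = c *: T x by have := T_lin c x 0; rewrite T0 !addr0.
have TB x y : T (x - y) = T x - T y by rewrite TD -scaleN1r TZ scaleN1r.
have [|n [a [r [r0 dense_n]]]] := @baire_ball _ _ Z (fun n => [set z | nrm (T z) <= n%:R]).
  move=> z; exists (Num.truncn (nrm (T z))).+1 => /=.
  exact/ltW/truncnS_gt.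
(* A vector rescaled to norm [r / 2] is approximated by a difference of two points with images of
   norm at most [n], whence the ratio [2 n / (r / 2)]. *)
pose C := 4 * n%:R / r.
have C0 : 0 <= C by rewrite /C divr_ge0 ?mulr_ge0 ?ler0n ?(ltW r0).
have approx z e : 0 < e -> exists2 w, nrm (T w) <= C * nrm z & nrm (z - w) <= e.
  move=> e0; have [->|z0] := eqVneq z 0.
    by exists 0; rewrite ?T0 ?subr0 !nrm0 ?mulr0// ltW.
  have nz : 0 < nrm z by rewrite nrm_gt0.
  pose t := r / 2 / nrm z.
  have t0 : 0 < t by rewrite !divr_gt0.
  have te0 : 0 < t * e / 2 by rewrite divr_gt0// mulr_gt0.
  have tz : nrm (a + realc t *: z - a) < r.
    by rewrite addrAC subrr add0r nrmZ gtr0_norm// divfK ?gt_eqF//; lra.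
  have [w1 /= Aw1 w1z] := dense_n (a + realc t *: z) (t * e / 2) tz te0.
  have [w2 /= Aw2 w2a] : exists2 w, nrm (T w) <= n%:R & nrm (w - a) < t * e / 2.
    by apply: dense_n => //; rewrite subrr nrm0.
  (* [w1] is near [a + t z] and [w2] near [a], each within [t * e / 2]; dividing the difference by
     [t] leaves an error of at most [e]. *)
  exists (realc t^-1 *: (w1 - w2)).
    rewrite TZ TB nrmZ normfV gtr0_norm// ler_pdivrMl//.
    have -> : t * (C * nrm z) = n%:R + n%:R by rewrite /t /C; field; rewrite !gt_eqF.
    by apply: le_trans (ler_nrm_sub _ _) _; lra.
  have -> : z - realc t^-1 *: (w1 - w2) = realc t^-1 *: (w2 - a - (w1 - (a + realc t *: z))).
    rewrite opprB addrA subrKA addrAC addrC -[w2 - w1]opprB [RHS]scalerBr scalerA.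
    by rewrite realcV mulVf ?scale1r// realc_eq0 gt_eqF.
  rewrite nrmZ normfV gtr0_norm// ler_pdivrMl//.
  by apply: le_trans (ler_nrm_sub _ _) _; lra.
have /choice[g gP] (ze : Z * R) : exists w, 0 < ze.2 ->
    nrm (T w) <= C * nrm ze.1 /\ nrm (ze.1 - w) <= ze.2.
  have [e0|] := ltP 0 ze.2; last by exists 0.
  by have [w] := approx ze.1 ze.2 e0; exists w.
(* The corrections have images of norm at most [C * nrm z / 2 ^ m], with sum [2 * C * nrm z]. *)
exists (2 * C) => [|z]; first by rewrite mulr_ge0.
have [->|z0] := eqVneq z 0; first by rewrite T0 !nrm0 mulr0.
have nz : 0 < nrm z by rewrite nrm_gt0.
clearbody C; pose e m := nrm z * 2^-1 ^+ m.
have e0 m : 0 < e m by rewrite mulr_gt0// exprn_gt0// invr_gt0.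
have eS m : e m.+1 = e m / 2 by rewrite /e exprSr mulrA.
have e_cvg : e @ \oo --> 0.
  rewrite -[0](mulr0 (nrm z)); apply: cvgMl_tmp.
  by apply: cvg_expr; rewrite ger0_norm; lra.
(* [v j] is what remains of [z] after [j] corrections. *)
pose fix v j := if j is m.+1 then v m - g (v m, e m.+1) else z.
have v_le m : nrm (v m) <= e m.
  case: m => [|m]; first by rewrite /e expr0 mulr1.
  by have [] := gP (v m, e m.+1) (e0 _).
have [||t Tv t_le] := @cvg_telescope _ _ W (T \o v) (fun m => 2 * C * e m).
- move=> m /=; rewrite TB addrAC subrr add0r nrmN.
  have -> : 2 * C * e m - 2 * C * e m.+1 = C * e m by rewrite eS; field.
  apply: le_trans (proj1 (gP (v m, e m.+1) (e0 _))) _.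
  exact: (ler_wpM2l C0 (v_le m)).
- have : (2 * C * e m @[m --> \oo]) --> 2 * C * 0 by apply: cvgMl_tmp.
  by rewrite mulr0.
have v_cvg : v @ \oo --> (0 : Z).
  apply/cvg_nrmP => d d0; move/cvgrPdist_lt : e_cvg => /(_ d d0).
  apply: filterS => m; rewrite !sub0r normrN nrmN gtr0_norm//.
  exact: le_lt_trans.
(* The residuals [v m] tend to 0 while [T (v m)] converges, so the limit of
   [T (v m)] is [T 0 = 0] and [t_le] at 0 bounds [T z] itself. *)
have := t_le 0%N; rewrite -(T_graph _ _ _ v_cvg Tv) T0 sub0r nrmN /=.
by rewrite /e expr0 mulr1.
Qed.

End ClosedGraph.

(** * Subspaces, distances and the gap *)

Section Subspaces.
Context {R : realType} {k : scalars} {Z : normedModType (scalar_field R k)}.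
Implicit Types (A X Y M : set Z) (x y z u v w : Z).

Lemma subspaceD A u v : is_subspace A -> A u -> A v -> A (u + v).
Proof. by move=> [_ AL] Au Av; rewrite -[u]scale1r; apply: AL. Qed.

Lemma subspaceZ A (c : scalar_field R k) u : is_subspace A -> A u -> A (c *: u).
Proof. by move=> [A0 AL] Au; rewrite -[_ *: _]addr0; apply: AL. Qed.

Lemma subspaceB A u v : is_subspace A -> A u -> A v -> A (u - v).
Proof. by move=> As Au Av; rewrite -scaleN1r; apply: subspaceD => //; apply: subspaceZ. Qed.

Lemma rel_img_subspace Y M : is_subspace Y -> is_subspace M ->
  is_subspace (rel_img Y M 0).
Proof.
move=> [Y0 YL] [M0 ML]; split=> [|c u v [Yu Mu] [Yv Mv]].
  by split; rewrite ?addr0.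
split; first exact: YL.
by move: Mu Mv; rewrite !add0r; apply: ML.
Qed.

Lemma dist_le A z v : A v -> dist z A <= nrm (z - v).
Proof.
move=> Av; apply: ge_inf; last by exists v.
by exists 0 => _ [w _ <-]; apply: nrm_ge0.
Qed.

Lemma dist_ge0 A z : A !=set0 -> 0 <= dist z A.
Proof.
move=> [v Av]; apply: lb_le_inf; first by exists (nrm (z - v)), v.
by move=> _ [w _ <-]; apply: nrm_ge0.
Qed.

Lemma dist_adherent A z e : A !=set0 -> 0 < e ->
  exists2 v, A v & nrm (z - v) < dist z A + e.
Proof.
move=> [v Av] e0.
have [||_ [w Aw <-] we] := @inf_adherent _ [set nrm (z - v) | v in A] e.
- by [].
- split; first by exists (nrm (z - v)), v.
  by exists 0 => _ [w _ <-]; apply: nrm_ge0.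
- by exists w.
Qed.

Lemma gap_has_ubound M N : is_subspace N ->
  has_ubound [set dist u N | u in [set u | M u /\ nrm u = 1]].
Proof.
move=> [N0 _]; exists 1 => _ [u [_ u1] <-].
by rewrite -u1 -{2}[u]subr0 dist_le.
Qed.

Lemma gap_ge0 M N : is_subspace N -> 0 <= gap M N.
Proof.
move=> Ns; rewrite /gap; case: ifP => // _.
set D := (X in sup X).
(* Without unit vectors in [M], [sup] takes its default value 0. *)
have [->|/set0P[r Dr]] := eqVneq D set0; first by rewrite sup0.
apply: le_trans (ub_le_sup (gap_has_ubound M Ns) Dr).
by case: Dr => u _ <-; apply: dist_ge0; exists 0; case: Ns.
Qed.

(** Rescaling carries the bound from unit vectors to all of [M]; the slack [e] is there because the
    distance to [N] need not be attained. *)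
Lemma gap_adherent M N u e : is_subspace M -> is_subspace N -> M u -> 0 < e ->
  exists2 v, N v & nrm (u - v) <= gap M N * nrm u + e.
Proof.
move=> Ms Ns Mu e0; have [->|u0] := eqVneq u 0.
  by exists 0; [case: Ns | rewrite subr0 nrm0 mulr0 add0r ltW].
have nu : 0 < nrm u by rewrite nrm_gt0.
pose t := (nrm u)^-1; pose u1 := realc t *: u.
have t0 : 0 < t by rewrite invr_gt0.
have Mu1 : M u1 by exact: subspaceZ.
have nu1 : nrm u1 = 1 by rewrite nrmZ gtr0_norm ?invr_gt0// mulVf ?gt_eqF.
have [|v Nv vu1] := @dist_adherent N u1 (t * e) _ (mulr_gt0 t0 e0).
  by exists 0; case: Ns.
have du1 : dist u1 N <= gap M N.
  rewrite /gap; case: ifPn => [/asboolP M0|_].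
    by move: Mu; rewrite M0 => /eqP; rewrite (negbTE u0).
  by apply: (ub_le_sup (gap_has_ubound M Ns)); exists u1.
exists (realc (nrm u) *: v); first exact: subspaceZ.
have -> : u - realc (nrm u) *: v = realc (nrm u) *: (u1 - v).
  by rewrite scalerBr scalerA realcV mulfV ?scale1r// realc_eq0 gt_eqF.
rewrite nrmZ gtr0_norm// mulrC -ler_pdivlMr//.
rewrite mulrDl mulfK ?gt_eqF// [e / _]mulrC -/t; lra.
Qed.

End Subspaces.

(** * The operator norm of a bounded linear map *)

Section OperatorNorm.
Context {R : realType} {k : scalars} {Z : normedModType (scalar_field R k)}.
Variables (T : Z -> Z) (C : R).
Hypotheses (T_lin : linear T) (C_ge0 : 0 <= C).
Hypothesis T_le : forall z, nrm (T z) <= C * nrm z.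

Let T0 : T 0 = 0.
Proof.
apply/eqP; rewrite -nrm_eq0 eq_le nrm_ge0 andbT.
by have := T_le 0; rewrite nrm0 mulr0.
Qed.

Lemma opnorm_bounds : (0 <= opnorm T <= C%:E)%E.
Proof.
apply/andP; split.
  by apply: le_ereal_sup_tmp; exists (nrm (T 0))%:E; [exists 0|];
    rewrite /= ?T0 nrm0.
apply: ge_ereal_sup => _ [z /= z1 <-]; rewrite lee_fin.
by apply: le_trans (T_le z) _; rewrite ler_piMr.
Qed.

(** Finiteness makes [fine (opnorm T)] the true norm: [fine] would send an infinite value to 0. *)
Lemma opnorm_fin_num : opnorm T \is a fin_num.
Proof.
have /andP[T_ge0 T_leC] := opnorm_bounds.
by rewrite ge0_fin_numE// (le_lt_trans T_leC)// ltry.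
Qed.

Lemma fine_opnorm_ge0 : 0 <= fine (opnorm T).
Proof. by rewrite fine_ge0//; have /andP[] := opnorm_bounds. Qed.

Lemma ler_opnorm z : nrm (T z) <= fine (opnorm T) * nrm z.
Proof.
have [->|z0] := eqVneq z 0; first by rewrite T0 nrm0 mulr0.
have nz : 0 < nrm z by rewrite nrm_gt0.
rewrite -ler_pdivrMr// mulrC -lee_fin fineK ?opnorm_fin_num//.
apply: ereal_sup_ubound; exists (realc (nrm z)^-1 *: z) => /=.
  by rewrite nrmZ gtr0_norm ?invr_gt0// mulVf ?gt_eqF.
have TZ (c : scalar_field R k) : T (c *: z) = c *: T z.
  by have := T_lin c z 0; rewrite T0 !addr0.
by rewrite TZ nrmZ gtr0_norm ?invr_gt0.
Qed.

End OperatorNorm.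

(** * The projection along a direct sum and its boundedness *)

Section Projection.
Context {R : realType} {k : scalars}
        {Z : normedModType (scalar_field R k)}.
Variables (X Y : set Z) (P : Z -> Z).
Hypotheses (X_sub : is_subspace X) (Y_sub : is_subspace Y).
Hypotheses (Z_XY : direct_sum X Y) (P_proj : projection_along X Y P).

(** The difference [P z - x] lies in both [X] and [Y]. *)
Lemma projection_uniq z x : X x -> Y (z - x) -> P z = x.
Proof.
move=> Xx Yzx; have [XP YP] := P_proj z.
apply/eqP; rewrite -subr_eq0; apply/eqP.
suff : (X `&` Y) (P z - x) by rewrite Z_XY.1.
split; first exact: subspaceB.
have -> : P z - x = z - x - (z - P z) by rewrite opprB [RHS]addrC subrKA.
exact: subspaceB.
Qed.

Lemma projectionE x y : X x -> Y y -> P (x + y) = x.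
Proof. by move=> Xx Yy; apply: projection_uniq; rewrite // addrAC subrr add0r. Qed.

Lemma projection_linear : linear P.
Proof.
move=> c u v; have [Xu Yu] := P_proj u; have [Xv Yv] := P_proj v.
apply: projection_uniq; first by apply: subspaceD => //; apply: subspaceZ.
rewrite opprD addrACA -scalerBr.
by apply: subspaceD => //; apply: subspaceZ.
Qed.

End Projection.

(** The graph is closed: if [u n] tends to [l] and [P (u n)] to [t], then [t] is in [X] and [l - t]
    in [Y], so [P l = t] by uniqueness. *)
Lemma projection_bounded {R : realType} {k : scalars}
    {Z : completeNormedModType (scalar_field R k)} (X Y : set Z) (P : Z -> Z) :
    is_subspace X -> is_subspace Y -> direct_sum X Y -> projection_along X Y P ->
    closed X -> closed Y ->
  exists2 C, 0 <= C & forall z, nrm (P z) <= C * nrm z.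
Proof.
move=> Xs Ys XY PXY Xc Yc.
apply: closed_graph (projection_linear Xs Ys XY PXY) _ => u l t ul Pu.
apply: (projection_uniq Xs Ys XY PXY).
  apply: (closed_cvg X Xc _ t Pu).
  by near=> n; case: (PXY (u n)).
apply: (closed_cvg Y Yc _ (l - t) (cvgB ul Pu)).
by near=> n => /=; case: (PXY (u n)).
Unshelve. all: by end_near. Qed.

(** * Moebius functions evaluated at a supremum *)

Section MoebiusEval.
Context {R : realType}.
Implicit Types (a b c d t l : R) (S : set R).

Lemma cvg_moebius_pinfty a b c d : 0 < c ->
  (a * t + b) / (c * t + d) @[t --> +oo] --> a / c.
Proof.
move=> c0; apply/cvgrPdist_le => e e0.
near=> t.
have ctd : 0 < c * t + d.
  by rewrite -ltrBlDr sub0r -ltr_pdivrMl//; near: t; apply: nbhs_pinfty_gt; apply: num_real.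
have -> : a / c - (a * t + b) / (c * t + d) = (a * d - b * c) / c / (c * t + d).
  by field; rewrite !gt_eqF.
rewrite normrM normfV normrM normfV (gtr0_norm c0) (gtr0_norm ctd).
rewrite ler_pdivrMr// -(ler_pdivrMl _ _ e0) -lerBlDr -(ler_pdivrMl _ _ c0).
by near: t; apply: nbhs_pinfty_ge; apply: num_real.
Unshelve. all: by end_near. Qed.

Lemma cvg_affine_pinfty a b : a < 0 -> (a * t + b)%:E @[t --> +oo] --> -oo%E.
Proof.
move=> a0; apply/cvgeNyPle => A; near=> t.
rewrite lee_fin -lerBrDr mulrC -(ler_ndivrMr _ _ a0).
by near: t; apply: nbhs_pinfty_ge; apply: num_real.
Unshelve. all: by end_near. Qed.

(** With positive denominators, the bound by [l] is the linear inequality [m * s <= n], which passes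
    to a finite supremum; an infinite one forces [m <= 0], which bounds the limit. *)
Lemma eval_ext_moebius_le a b c d l S : 0 <= c -> 0 < d -> S !=set0 ->
    (forall s, S s -> 0 <= s) ->
    (forall s, S s -> a * s + b <= l * (c * s + d)) ->
  (eval_ext (fun s => (a * s + b) / (c * s + d))%R (ereal_sup [set s%:E | s in S])
   <= l%:E)%E.
Proof.
move=> c0 d0 [s0 Ss0] S_ge0 S_le.
pose m := a - l * c; pose n := l * d - b.
have S_mn s : S s -> m * s <= n by move=> /S_le; rewrite /m /n; lra.
have sup_le t : (forall s, S s -> s <= t) -> (ereal_sup [set s%:E | s in S] <= t%:E)%E.
  by move=> St; apply: ge_ereal_sup => _ [s Ss <-]; rewrite lee_fin St.
have sup_le_m : 0 < m -> (ereal_sup [set s%:E | s in S] <= (n / m)%:E)%E.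
  by move=> m0; apply: sup_le => s Ss; rewrite ler_pdivlMr// mulrC S_mn.
have le_sup s : S s -> (s%:E <= ereal_sup [set s%:E | s in S])%E.
  by move=> Ss; apply: ereal_sup_ubound; exists s.
case: (ereal_sup _) sup_le_m le_sup => [t||] sup_le_m le_sup; last first.
- by have := le_sup s0 Ss0.
- have m_le0 : m <= 0 by rewrite leNgt; apply/negP => /sup_le_m.
  have [c1|c_le0] := ltP 0 c.
    have f_cvg : ((a * s + b) / (c * s + d))%:E @[s --> +oo] --> (a / c)%:E.
      apply: cvg_EFin; first exact: nearW.
      exact: cvg_moebius_pinfty.
    rewrite /= (cvg_lim _ f_cvg)//.
      by rewrite lee_fin ler_pdivrMr//; move: m_le0; rewrite /m; lra.
  (* The function is now affine; [m <= 0] says [a <= 0], so its limit is either minus infinity or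
     the constant [b / d]. *)
  have {c0 c_le0} c0 : c = 0 by apply/eqP; rewrite eq_le c_le0.
  have f_affine : (fun s => ((a * s + b) / (c * s + d))%:E) =
                  (fun s => (a / d * s + b / d)%:E).
    by apply/funext => s; rewrite c0 mul0r add0r; congr EFin; field; rewrite gt_eqF.
  rewrite /= f_affine.
  have [a0|a_ge0] := ltP a 0.
    rewrite (cvg_lim _ (cvg_affine_pinfty _ _))// ?leNye//.
    by rewrite pmulr_llt0// invr_gt0.
  have {a_ge0} a0 : a = 0 by move: m_le0; rewrite /m c0; lra.
  rewrite a0 mul0r (_ : (fun s => _) = fun=> (b / d)%:E); last first.
    by apply/funext => s; rewrite mul0r add0r.
  rewrite lim_cst// lee_fin ler_pdivrMr//.
  by have := S_le _ Ss0; rewrite a0 c0; lra.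
- have t_ge0 : 0 <= t.
    by have := le_sup _ Ss0; rewrite lee_fin; apply: le_trans; apply: S_ge0.
  rewrite /= lee_fin ler_pdivrMr; last first.
    by have := mulr_ge0 c0 t_ge0; lra.
  suff : m * t <= n by rewrite /m /n; lra.
  (* For [m <= 0] one point suffices: [s0 <= t] gives [m * t <= m * s0 <= n]. *)
  have [m0|m0] := ltP 0 m.
    by have := sup_le_m m0; rewrite lee_fin ler_pdivlMr// mulrC.
  apply: le_trans (S_mn _ Ss0); rewrite ler_wnM2l//.
  by have := le_sup _ Ss0; rewrite lee_fin.
Qed.

End MoebiusEval.

(** * The estimate at a single vector of the domain *)

Section Stability.
Context {R : realType} {k : scalars} {Z : normedModType (scalar_field R k)}.
Variables (X Y M N : set Z) (P : Z -> Z) (p q : R) (c : nat).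
Hypotheses (X_sub : is_subspace X) (Y_sub : is_subspace Y).
Hypotheses (M_sub : is_subspace M) (N_sub : is_subspace N).
Hypotheses (Z_XY : direct_sum X Y) (P_proj : projection_along X Y P).
Hypotheses (p_ge0 : 0 <= p) (q_ge0 : 0 <= q).
Hypothesis P_le : forall z, nrm (P z) <= p * nrm z.
Hypothesis Q_le : forall z, nrm (z - P z) <= q * nrm z.
Let d := gap M N.
Let d0 := gap (rel_img Y N 0) (rel_img Y M 0).

(** Divided by [nrm x], this is the Moebius bound at one quotient with denominators cleared. [L]
    bounds [nrm (x + y)] up to the slack, and [c p + q] bounds the effect on [c x - y] of moving
    from [M] to [N]. *)
Lemma rel_dist_stable b x (r := dist (x *+ c) (rel_img Y M x))
    (L := (1 + c%:R) * nrm x + r) : 0 <= b ->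
    (forall x', rel_dom X Y N x' ->
       dist (x' *+ c) (rel_img Y N x') <= b * nrm x') ->
    rel_dom X Y M x ->
  (1 - d0) / (1 + d0) * r - (c%:R * p + q) * L * d <=
  b * (nrm x + p * L * d).
Proof.
move=> b_ge0 N_le xM; have [Xx [y0 Yy0 Mxy0]] := xM.
have N0_sub := rel_img_subspace Y_sub N_sub.
have M0_sub := rel_img_subspace Y_sub M_sub.
have d_ge0 : 0 <= d by exact: gap_ge0.
have d0_ge0 : 0 <= d0 by exact: gap_ge0.
have c_ge0 : 0 <= c%:R :> R by [].
apply/ler_addgt0Pr => e e_gt0.
(* [K] is the total coefficient of the slack [h] in the final estimate, hence the choice
   [h = e / K]. *)
pose K := (c%:R * p + q + b * p) * (d + 1) + 2.
have K_gt0 : 0 < K by rewrite ltr_wpDl// !(mulr_ge0, addr_ge0).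
have h_gt0 : 0 < e / K by rewrite divr_gt0.
have eK : e = e / K * K by rewrite divfK ?gt_eqF.
rewrite {}eK; move: (e / K) h_gt0 => h h_gt0 {e e_gt0}.
have [|y [Yy Mxy]] := @dist_adherent _ _ _ (rel_img Y M x) (x *+ c) h _ h_gt0.
  by exists y0.
rewrite -/r => xy_lt.
have u_le : nrm (x + y) <= L + h.
  have -> : x + y = x + x *+ c - (x *+ c - y) by rewrite opprB addrACA subrr addr0.
  apply: le_trans (ler_nrm_sub _ _) _.
  have := ler_nrmD x (x *+ c); rewrite nrmMn -mulr_natl /L; lra.
have [v Nv uv_le] := gap_adherent M_sub N_sub Mxy h_gt0.
pose T := d * L + (d + 1) * h.
have {uv_le}uv_le : nrm (x + y - v) <= T.
  by apply: le_trans uv_le _; have := ler_wpM2l d_ge0 u_le; rewrite /T /d; lra.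
have [XPv YPv] := P_proj v.
have [P_lin PE] := (projection_linear X_sub Y_sub Z_XY P_proj,
                    projectionE X_sub Y_sub Z_XY P_proj Xx Yy).
have PB : P (x + y - v) = x - P v.
  by have := P_lin (-1) v (x + y); rewrite PE !scaleN1r [- v + _]addrC [- P v + x]addrC.
have xx' : nrm (x - P v) <= p * T.
  by rewrite -PB (le_trans (P_le _))// ler_wpM2l.
have yy' : nrm (y - (v - P v)) <= q * T.
  have -> : y - (v - P v) = x + y - v - P (x + y - v).
    by rewrite PB !opprB -[x + y - v]addrA [RHS]addrC subrKA addrCA.
  by rewrite (le_trans (Q_le _))// ler_wpM2l.
have dom_x' : rel_dom X Y N (P v).
  by split=> //; exists (v - P v); rewrite // addrC subrK.
have [|y'' [Yy'' Nxy'']] :=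
    @dist_adherent _ _ _ (rel_img Y N (P v)) (P v *+ c) h _ h_gt0.
  by exists (v - P v); split; rewrite // addrC subrK.
have x'_le : nrm (P v) <= nrm x + p * T.
  by have := ler_nrm_dist (P v) x; rewrite nrmB; lra.
have := N_le _ dom_x'; have := ler_wpM2l b_ge0 x'_le => bx' dN x'y''.
(* Two values of [N] at the same point [P v] differ by an element of [N0]. *)
pose n := y'' - (v - P v).
have N0n : rel_img Y N 0 n.
  split; first exact: subspaceB.
  rewrite add0r; have -> : n = P v + y'' - v by rewrite /n opprB addrCA addrA.
  exact: subspaceB.
have [m [Ym]] := gap_adherent N0_sub M0_sub N0n h_gt0.
rewrite add0r -/d0 => Mm nm_le.
pose w := x *+ c - y.
(* Adding [m] from [M0] to [y] stays in [M x]. *)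
have r_le : r <= nrm (w - m).
  rewrite /w -addrA -opprD; apply: dist_le; split; first exact: subspaceD.
  by rewrite addrA; apply: subspaceD.
pose D := nrm (w - n).
(* With [x' = P v] and [y' = v - P v], split [w - n] as [c (x - x') - (y - y') + (c x' - y'')]. *)
have D_le : D <= (c%:R * p + q) * T + b * (nrm x + p * T) + h.
  have -> : D = nrm ((x - P v) *+ c - (y - (v - P v)) + (P v *+ c - y'')).
    congr nrm; rewrite /w /n mulrnBl; set B := v - P v.
    by rewrite !opprB addrACA [RHS]addrAC subrKA [RHS]addrACA [- y - y'']addrC.
  apply: le_trans (ler_nrmD _ _) _.
  have := ler_nrm_sub ((x - P v) *+ c) (y - (v - P v)).
  have := ler_wpM2l c_ge0 xx'; rewrite nrmMn -[_ *+ c]mulr_natl.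
  lra.
have wm_le := ler_nrm_triangle n w m.
have n_le : nrm n <= r + h + D.
  by have := ler_nrm_dist n w; rewrite (nrmB n w) -/D; rewrite -/w in xy_lt; lra.
have := ler_wpM2l d0_ge0 n_le => d0n.
(* The chain [r <= D + nrm (n - m) <= D + d0 (r + h + D) + h] rearranges to
   [(1 - d0) r <= (1 + d0) (D + h)]. *)
have : (1 - d0) / (1 + d0) * r <= D + h.
  rewrite mulrAC ler_pdivrMr; last by lra.
  by rewrite -/D in wm_le; lra.
by rewrite /K /T in D_le *; lra.
Qed.

End Stability.

(** * Passage to the suprema defining [rel_a] and [rel_norm] *)

Section RelDistSup.
Context {R : realType} {k : scalars} {Z : normedModType (scalar_field R k)}.
Implicit Types (X Y M N : set Z) (c : nat).

(* [c = 1] gives [rel_a], [c = 0] gives [rel_norm]. *)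
Definition rel_dist_sup c X Y M : \bar R :=
  if `[< rel_dom X Y M = [set 0] >] then 0%E
  else ereal_sup [set (dist (x *+ c) (rel_img Y M x) / nrm x)%:E
                 | x in rel_dom X Y M `\ 0].

Lemma rel_img_neq0 X Y M x : rel_dom X Y M x -> rel_img Y M x !=set0.
Proof. by move=> [_ [y Yy Mxy]]; exists y. Qed.

Lemma inf_nrm_div (A : set Z) (r : R) : A !=set0 -> 0 < r ->
  inf [set nrm y / r | y in A] = dist 0 A / r.
Proof.
move=> A0 r0; have [a Aa] := A0.
apply/eqP; rewrite eq_le; apply/andP; split.
  rewrite ler_pdivlMr//; apply: lb_le_inf; first by exists (nrm (0 - a)), a.
  move=> _ [y Ay <-]; rewrite sub0r nrmN -ler_pdivlMr//.
  apply: ge_inf; last by exists y.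
  by exists 0 => _ [z _ <-]; rewrite divr_ge0 ?nrm_ge0// ltW.
apply: lb_le_inf; first by exists (nrm a / r), a.
move=> _ [y Ay <-]; rewrite ler_pM2r ?invr_gt0// -(nrmN y) -sub0r.
exact: dist_le.
Qed.

Lemma rel_normE X Y M : rel_norm X Y M = rel_dist_sup 0 X Y M.
Proof.
rewrite /rel_norm /rel_dist_sup; case: ifP => // _; congr ereal_sup.
apply: eq_imagel => x [xM /eqP x0]; rewrite inf_nrm_div ?nrm_gt0//.
exact: rel_img_neq0 xM.
Qed.

Lemma rel_dom0 X Y M : is_subspace X -> is_subspace Y -> is_subspace M ->
  rel_dom X Y M 0.
Proof. by move=> [X0 _] [Y0 _] [M0 _]; split=> //; exists 0; rewrite ?addr0. Qed.

Lemma rel_dom_nonzero X Y M :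
    is_subspace X -> is_subspace Y -> is_subspace M ->
  rel_dom X Y M <> [set 0] -> rel_dom X Y M `\ 0 !=set0.
Proof.
move=> Xs Ys Ms; apply: contra_notP => /set0P/negP/negPn/eqP MD0.
apply/seteqP; split=> [x xM|_ ->]; last exact: rel_dom0.
by apply: contrapT => x0; have : (rel_dom X Y M `\ 0) x by []; rewrite MD0.
Qed.

Lemma rel_dist_sup_ge0 c X Y M :
    is_subspace X -> is_subspace Y -> is_subspace M ->
  (0 <= rel_dist_sup c X Y M)%E.
Proof.
move=> Xs Ys Ms; rewrite /rel_dist_sup; case: ifPn => // /asboolP.
move=> /(rel_dom_nonzero Xs Ys Ms)[x [xM x0]]; apply: le_ereal_sup_tmp.
exists (dist (x *+ c) (rel_img Y M x) / nrm x)%:E; first by exists x.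
by rewrite lee_fin divr_ge0 ?nrm_ge0// dist_ge0//; exact: rel_img_neq0 xM.
Qed.

(** This form covers [x = 0], absent from the supremum, because the nearby point [P v] in
    [rel_dist_stable] may vanish; there [0] in [M0] makes the distance at most 0. *)
Lemma dist_le_rel_dist_sup c X Y M b x :
    is_subspace Y -> is_subspace M ->
    rel_dist_sup c X Y M = b%:E -> rel_dom X Y M x ->
  dist (x *+ c) (rel_img Y M x) <= b * nrm x.
Proof.
move=> Ys Ms Mb xM; have [x0|x0] := eqVneq x 0.
  have [img0 _] := rel_img_subspace Ys Ms.
  by have := dist_le 0 img0; rewrite x0 mul0rn nrm0 mulr0 subr0 nrm0.
move: Mb; rewrite /rel_dist_sup; case: ifPn => [/asboolP M0|_ Mb].
  by move: xM; rewrite M0 => /eqP; rewrite (negbTE x0).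
rewrite -ler_pdivrMr ?nrm_gt0// -lee_fin -Mb.
by apply: ereal_sup_ubound; exists x => //; split=> //; apply/eqP.
Qed.

Lemma rel_dist_sup_stable c X Y M N (P : Z -> Z) (p q : R)
    (d := gap M N) (d0 := gap (rel_img Y N 0) (rel_img Y M 0)) :
    is_subspace X -> is_subspace Y -> is_subspace M -> is_subspace N ->
    direct_sum X Y -> projection_along X Y P -> 0 <= p -> 0 <= q ->
    (forall z, nrm (P z) <= p * nrm z) ->
    (forall z, nrm (z - P z) <= q * nrm z) ->
  (eval_ext (fun t => ((1 - d0) / (1 + d0) * t
                       - (c%:R * p + q) * (1 + c%:R + t) * d) /
                      (1 + p * (1 + c%:R + t) * d))%R
     (rel_dist_sup c X Y M) <= rel_dist_sup c X Y N)%E.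
Proof.
move=> Xs Ys Ms Ns XY PXY p0 q0 P_le Q_le.
have d_ge0 : 0 <= d by exact: gap_ge0.
have c1_ge0 : 0 <= 1 + c%:R :> R by rewrite addr_ge0.
have cpq_ge0 : 0 <= c%:R * p + q by rewrite addr_ge0// mulr_ge0.
have pd_ge0 : 0 <= p * d by rewrite mulr_ge0.
have den_gt0 : 0 < 1 + p * (1 + c%:R) * d by rewrite ltr_wpDr// !mulr_ge0.
have := rel_dist_sup_ge0 c Xs Ys Ns.
case Nb : (rel_dist_sup c X Y N) => [b||] // b_ge0; last exact: leey.
rewrite lee_fin in b_ge0.
rewrite {1}/rel_dist_sup; case: ifPn => [_|/asboolP M_neq0].
  (* For a zero domain the expression is evaluated at 0, where its numerator is nonpositive. *)
  rewrite /= lee_fin (le_trans _ b_ge0)// !addr0 mulr0 sub0r.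
  by rewrite pmulr_lle0 ?invr_gt0// oppr_le0 !mulr_ge0.
have -> : (fun t => ((1 - d0) / (1 + d0) * t
                       - (c%:R * p + q) * (1 + c%:R + t) * d) /
                      (1 + p * (1 + c%:R + t) * d)) =
   (fun t => (((1 - d0) / (1 + d0) - (c%:R * p + q) * d) * t
               + - ((c%:R * p + q) * (1 + c%:R) * d)) /
             (p * d * t + (1 + p * (1 + c%:R) * d))).
  by apply/funext => t; congr (_ / _); ring.
rewrite -(image_comp (fun x => dist (x *+ c) (rel_img Y M x) / nrm x) EFin).
apply: eval_ext_moebius_le => //.
- by have [x xM] := rel_dom_nonzero Xs Ys Ms M_neq0; eexists; exists x.
- move=> _ [x [xM _] <-]; rewrite divr_ge0 ?nrm_ge0// dist_ge0//.
  exact: rel_img_neq0 xM.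
move=> _ [x [xM /eqP x0] <-].
have nx : 0 < nrm x by rewrite nrm_gt0.
have := rel_dist_stable Xs Ys Ms Ns XY PXY p0 q0 P_le Q_le b_ge0
  (fun x' => dist_le_rel_dist_sup Ys Ns Nb) xM.
rewrite -/d -/d0; set r := dist _ _; set s := r / nrm x.
have -> : r = s * nrm x by rewrite divfK ?gt_eqF.
move=> H; rewrite -(ler_pM2r nx); move: H.
by set e := (1 - d0) / (1 + d0); lra.
Qed.

End RelDistSup.

(** * Both estimates with the actual norms of the projections *)

Theorem theoremA7 (R : realType) (k : scalars)
  (Z : completeNormedModType (scalar_field R k))
  (X Y M N : set Z) (P : Z -> Z)
  (X_sub : is_subspace X) (X_closed : closed X)
  (Y_sub : is_subspace Y) (Y_closed : closed Y)
  (Z_XY : direct_sum X Y)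
  (P_proj : projection_along X Y P)
  (M_sub : is_subspace M) (N_sub : is_subspace N) :
  let p := fine (opnorm P) in
  let q := fine (opnorm (fun z => z - P z)) in
  let eta := p + q in
  let d := gap M N in
  let d0 := gap (rel_img Y N 0) (rel_img Y M 0) in
  let rhs_a := eval_ext (fun a : R =>
    ((1 - d0) / (1 + d0) * a - eta * (2 + a) * d) / (1 + p * (2 + a) * d))
    (rel_a X Y M) in
  let rhs_norm := eval_ext (fun m : R =>
    ((1 - d0) / (1 + d0) * m - q * (1 + m) * d) / (1 + p * (1 + m) * d))
    (rel_norm X Y M) in
  [/\ opnorm P \is a fin_num /\ opnorm (fun z => z - P z) \is a fin_num,
      (exists z : Z, z != 0) -> 1 <= eta,
      (rhs_a <= rel_a X Y N)%E
    & (rhs_norm <= rel_norm X Y N)%E].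
Proof.
have P_lin := projection_linear X_sub Y_sub Z_XY P_proj.
have [C C0 P_leC] := projection_bounded X_sub Y_sub Z_XY P_proj X_closed Y_closed.
have Q_lin : linear (fun z => z - P z).
  by move=> c u v; rewrite P_lin opprD addrACA -scalerBr.
have C1_ge0 : 0 <= 1 + C by rewrite addr_ge0.
have Q_leC z : nrm (z - P z) <= (1 + C) * nrm z.
  by apply: le_trans (ler_nrm_sub _ _) _; have := P_leC z; lra.
have P_le := ler_opnorm P_lin C0 P_leC.
have Q_le := ler_opnorm Q_lin C1_ge0 Q_leC.
have p_ge0 := fine_opnorm_ge0 C0 P_leC.
have q_ge0 := fine_opnorm_ge0 C1_ge0 Q_leC.
move=> p q eta d d0 rhs_a rhs_norm.
have stable c := rel_dist_sup_stable c X_sub Y_sub M_sub N_sub Z_XY P_proj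
  p_ge0 q_ge0 P_le Q_le.
split.
- split; first exact: opnorm_fin_num C0 P_leC.
  exact: opnorm_fin_num C1_ge0 Q_leC.
- move=> [z]; rewrite -nrm_gt0 => nz; rewrite -(ler_pM2r nz) mul1r mulrDl.
  have := ler_nrmD (P z) (z - P z); rewrite addrC subrK => /le_trans; apply.
  by rewrite lerD.
(* At [c = 1] the coefficient [c p + q] is [eta] and [1 + c] is 2; at [c = 0] they are [q] and 1. *)
- by have := stable 1%N; rewrite mul1r -[1 + 1%:R]/2%:R.
- rewrite /rhs_norm !rel_normE.
  by have := stable 0%N; rewrite mul0r add0r addr0.
Qed.
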